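(* Let $k\ge 2$ be an integer and let $m\ge 7$ be an odd integer. Then $$GR_k(\widehat{K}_m)\ \ge\ \begin{cases} \max\{2R_2(\widehat{K}_m)-1,\ 5m+1\}, & \text{if } k=3;\\ R_2(\widehat{K}_m)+5(m-3)\bigl(5^{\frac{k-2}{2}}-1\bigr)-(m-5)(k-2), & \text{if } k \text{ is even and } m\equiv 1 \pmod 4;\\ R_2(\widehat{K}_m)+5(m-2)\bigl(5^{\frac{k-2}{2}}-1\bigr)-(m-3)(k-2), & \text{if } k \text{ is even and } m\equiv 3 \pmod 4;\\ 2\bigl(R_2(\widehat{K}_m)+5(m-3)(5^{\frac{k-3}{2}}-1)-(m-5)(k-3)\bigr)-1, & \text{if } k\ge 5 \text{ is odd and } m\equiv 1 \pmod 4;\\ 2\bigl(R_2(\widehat{K}_m)+5(m-2)(5^{\frac{k-3}{2}}-1)-(m-3)(k-3)\bigr)-1, & \text{if } k\ge 5 \text{ is odd and } m\equiv 3 \pmod 4. \end{cases}$$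
   Context: Graphs are finite and simple. The kipas $\widehat{K}_m=K_1+P_m$ is the graph obtained from the path $P_m$ on $m$ vertices by adding one new vertex adjacent to every vertex of the path. $R_2(G)=R(G,G)$ is the 2-color Ramsey number: the smallest positive integer $N$ such that every coloring of the edges of $K_N$ with two colors contains a monochromatic subgraph isomorphic to $G$. A Gallai coloring is an edge coloring that contains no rainbow triangle, i.e. no triangle whose three edges have three pairwise different colors. For a graph $G$ and a positive integer $k$, the Gallai-Ramsey number $GR_k(G)$ is the smallest positive integer $N$ such that every Gallai coloring $\tau:E(K_N)\to\{1,\dots,k\}$ (not all colors need be used) contains a monochromatic subgraph isomorphic to $G$. *)

(* Defs.v *)
From mathcomp Require Import all_boot.

Set Implicit Arguments.
Unset Strict Implicit.
Unset Printing Implicit Defensive.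

Record sgraph := SGraph {
  vertex :> finType;
  adj : rel vertex;
  adj_sym : symmetric adj;
  adj_irrefl : irreflexive adj }.

(* [None] is the hub and [Some i] is the i-th vertex of the path. *)
Definition kipas_adj (m : nat) : rel (option 'I_m) := fun x y =>
  match x, y with
  | None, None => false
  | Some i, Some j => (i.+1 == j :> nat) || (j.+1 == i :> nat)
  | _, _ => true
  end.

Lemma kipas_adj_sym m : symmetric (@kipas_adj m).
Proof. by move=> [i|] [j|] //=; rewrite orbC. Qed.

Lemma kipas_adj_irrefl m : irreflexive (@kipas_adj m).
Proof. by move=> [i|] //=; rewrite orbb; exact: gtn_eqF. Qed.

Definition kipas (m : nat) : sgraph :=
  SGraph (@kipas_adj_sym m) (@kipas_adj_irrefl m).

(* The colour of the edge xy is [c [set x; y]]; the values of [c] on sets that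
   are not 2-element sets are never used. *)
Definition coloring (N k : nat) : finType := {ffun {set 'I_N} -> 'I_k}.

(* The copy is a subgraph of K_N, not required to be induced in its colour
   class. *)
Definition mono_copy (G : sgraph) (N k : nat) (c : coloring N k) : bool :=
  [exists i : 'I_k, [exists f : {ffun G -> 'I_N},
     injectiveb f &&
     [forall x, forall y, adj x y ==> (c [set f x; f y] == i)]]].

Definition rainbow_triangle (N k : nat) (c : coloring N k) (x y z : 'I_N) :=
  [&& x != y, y != z, x != z,
      c [set x; y] != c [set y; z],
      c [set y; z] != c [set x; z] & c [set x; y] != c [set x; z]].

Definition gallai (N k : nat) (c : coloring N k) : bool :=
  ~~ [exists x, exists y, exists z, rainbow_triangle c x y z].

Definition ramsey_pred (k : nat) (G : sgraph) (N : nat) : bool :=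
  (0 < N) && [forall c : coloring N k, mono_copy G c].

Definition gallai_ramsey_pred (k : nat) (G : sgraph) (N : nat) : bool :=
  (0 < N) && [forall c : coloring N k, gallai c ==> mono_copy G c].

Lemma ramsey_clique (k : nat) (s : 'I_k -> nat) :
  exists M : nat, forall N (c : coloring N k) (A : {set 'I_N}), M <= #|A| ->
  exists i : 'I_k, exists2 B : {set 'I_N}, B \subset A & (#|B| = s i) /\
    (forall x y, x \in B -> y \in B -> x != y -> c [set x; y] = i).
Proof.
have [n] := ubnP (\sum_i s i); elim: n => // n IHn in s *; rewrite ltnS => le_n.
have [[i si0]|s_gt0] := altP (@existsP _ (fun i => s i == 0)).
  exists 0 => N c A _; exists i, set0; rewrite ?sub0set // cards0 (eqP si0).
  by split=> // x y; rewrite inE.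
have {}s_gt0 i : 0 < s i.
  by rewrite lt0n; apply: contra s_gt0 => si0; apply/existsP; exists i.
pose s' i j := if j == i then (s j).-1 else s j.
have Ms i : exists M : nat,
    forall N (c : coloring N k) (A : {set 'I_N}), M <= #|A| ->
    exists j : 'I_k, exists2 B : {set 'I_N}, B \subset A & (#|B| = s' i j) /\
    (forall x y, x \in B -> y \in B -> x != y -> c [set x; y] = j).
  apply: IHn; apply: leq_trans le_n.
  rewrite (bigD1 i) // [X in _ < X](bigD1 i) //= /s' eqxx.
  rewrite (eq_bigr s) => [|j /negPf-> //]; rewrite -addSn prednK //.
have [M MP] : exists M : 'I_k -> nat, forall i,
    forall N (c : coloring N k) (A : {set 'I_N}), M i <= #|A| ->
    exists j : 'I_k, exists2 B : {set 'I_N}, B \subset A & (#|B| = s' i j) /\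
    (forall x y, x \in B -> y \in B -> x != y -> c [set x; y] = j).
  have [F FP] := fin_all_exists Ms; by exists F.
exists (\sum_i M i).+2 => N c A ltA.
have [v vA] : exists v, v \in A.
  by apply/set0Pn; rewrite -card_gt0 (leq_trans _ ltA).
pose Ai i := [set x in A :\ v | c [set v; x] == i].
have [i leM] : exists i, M i <= #|Ai i|.
  apply/existsP; apply: contraLR ltA => /existsPn ltM.
  rewrite -ltnNge ltnS (cardsD1 v) vA add1n ltnS.
  rewrite -sum1_card (partition_big (fun x => c [set v; x]) predT) //=.
  apply: leq_sum => i _; rewrite sum1_card.
  have := ltM i; rewrite -ltnNge => /ltnW; apply: leq_trans.
  apply: subset_leq_card; apply/subsetP=> x.
  by rewrite [in X in _ -> X]inE unfold_in.
have [j [B sBA [cardB monoB]]] := MP i N c _ leM.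
have sAiA : Ai i \subset A by apply/subsetP=> x; rewrite !inE => /andP[/andP[]].
move: cardB; rewrite /s'; case: eqP => [eqji|_] cardB; last first.
  by exists j, B => //; exact: subset_trans sAiA.
have BP x : x \in B -> x != v /\ c [set v; x] = i.
  by move/(subsetP sBA); rewrite !inE => /andP[/andP[-> _] /eqP].
exists j, (v |: B).
  by rewrite subUset sub1set vA (subset_trans sBA).
split.
  rewrite cardsU1 cardB; case: (boolP (v \in B)) => [/BP[]|_].
    by rewrite eqxx.
  by rewrite add1n prednK.
move=> x y /setU1P[->|xB] /setU1P[->|yB]; first by rewrite eqxx.
- by move=> _; rewrite eqji; case: (BP y yB).
- by move=> _; rewrite eqji setUC; case: (BP x xB).
- exact: monoB.
Qed.

Lemma ramsey_exists (k : nat) (G : sgraph) : exists N, ramsey_pred k G N.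
Proof.
have [M MP] := @ramsey_clique k (fun=> #|G|).
exists M.+1; apply/andP; split=> //; apply/forallP=> c.
have [|i [B _ [cardB monoB]]] := MP _ c [set: 'I_M.+1].
  by rewrite cardsT card_ord leqnSn.
apply/existsP; exists i; apply/existsP.
pose f (x : G) : 'I_M.+1 := enum_val (cast_ord (esym cardB) (enum_rank x)).
have f_inj : injective f.
  by move=> x y /enum_val_inj /cast_ord_inj /enum_rank_inj.
exists [ffun x => f x]; apply/andP; split.
  by apply/injectiveP=> x y; rewrite !ffunE => /f_inj.
apply/forallP=> x; apply/forallP=> y; apply/implyP=> xy; rewrite !ffunE.
apply/eqP/monoB; rewrite ?enum_valP //.
by apply: contraTneq xy => /f_inj->; rewrite adj_irrefl.
Qed.

Lemma gallai_ramsey_exists (k : nat) (G : sgraph) :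
  exists N, gallai_ramsey_pred k G N.
Proof.
have [N /andP[N_gt0 /forallP cG]] := ramsey_exists k G.
exists N; rewrite /gallai_ramsey_pred N_gt0; apply/forallP=> c.
by rewrite cG implybT.
Qed.

Definition ramsey (k : nat) (G : sgraph) : nat := ex_minn (ramsey_exists k G).

Definition gallai_ramsey (k : nat) (G : sgraph) : nat :=
  ex_minn (gallai_ramsey_exists k G).

(* Main.v *)
(* The kipas contains a triangle, so it does not occur in the colours of the
   edges between the blocks of a blown-up pentagon unless those colours also
   occur inside the blocks.  They may occur there a little: with r = (m-3)/2, a
   colour class inside a block may have maximum degree r and no path on m
   vertices, provided that the blocks adjacent in this colour are free of it; a
   path in the neighbourhood of a hub then has at most 2r + 1 < m vertices.

   So let b be m - 2 or m - 3 according to m mod 4, and take a 2-coloured K_b in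
   which both colours have maximum degree at most r, and a 1-coloured K_(r+1).
   Nesting pentagons j times with new colours at each level gives a block with
   5^j b vertices, in which two extra colours are as above, or one with
   5^j b - (b - r - 1) vertices and a single such extra colour.  The colouring
   for k + 2 colours puts the one for k colours in one block of a pentagon and
   the trimmed blocks in the four others, whose extra colours are the two
   colours of the pentagon.  The recursion starts at a critical 2-colouring for
   the Ramsey number.  For odd k, two copies are joined by one new colour. *)

Require Import Defs.
From mathcomp Require Import all_boot all_order all_algebra.
From mathcomp Require Import zify ring.

Set Implicit Arguments.
Unset Strict Implicit.
Unset Printing Implicit Defensive.

(** * Gallai colourings and sparse colour classes *)

(** Colours are natural numbers, so that fresh ones are always at hand. The diagonal values of [hue]
    are arbitrary; [hue_rel] discards them. *)
Record gallai_graph := GallaiGraph {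
  node :> finType;
  hue : node -> node -> nat;
  hue_sym : forall x y, hue x y = hue y x;
  hue_gallai : forall x y z, x != y -> y != z -> x != z ->
    [|| hue x y == hue y z, hue y z == hue x z | hue x y == hue x z] }.

Definition hue_rel (G : gallai_graph) (a : nat) : rel G :=
  fun x y => (x != y) && (@hue G x y == a).

(* How much of a colour is allowed in a block: none (0), as much as is harmless
   next to blocks without this colour (1), or no kipas (2 and more). *)
Definition sparse (m l : nat) (T : finType) (e : rel T) : Prop :=
  match l with
  | 0 => forall x y, ~~ e x y
  | 1 => (forall x, #|e x| <= (m - 3)./2) /\
         (forall s, uniq s -> sorted e s -> size s < m)
  | _ => forall v s, uniq s -> sorted e s -> all (e v) s -> size s <> m
  end.

Lemma sparse_le m l l' (T : finType) (e : rel T) :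
  3 <= m -> l <= l' -> sparse m l e -> sparse m l' e.
Proof.
move=> m3; have s01 : sparse m 0 e -> sparse m 1 e.
  move=> e0; split=> [x|[|x [|y s]] //= _].
  - by rewrite eq_card0 // => y; apply/negbTE/e0.
  - lia.
  - lia.
  - by rewrite (negbTE (e0 x y)).
have s12 : sparse m 1 e -> sparse m 2 e.
  by case=> _ es v s us ss _ sz; have := es s us ss; rewrite sz ltnn.
case: l l' => [|[|l]] [|[|l']] // _; by move/s01/s12.
Qed.

(** * Lexicographic products of relations *)

Definition lex_rel {I : finType} {T : I -> finType} (h : rel I)
    (e : forall i, rel (T i)) : rel {i : I & T i} :=
  fun u v => if tag u == tag v then e (tag u) (tagged u) (tagged_as u v)
             else h (tag u) (tag v).

Section LexRel.
Variables (I : finType) (T : I -> finType) (h : rel I) (e : forall i, rel (T i)).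

Lemma lex_rel_in i (x : T i) v : lex_rel h e (Tagged T x) v ->
  (exists2 y, v = Tagged T y & @e i x y) \/ (i != tag v /\ h i (tag v)).
Proof.
case: v => j y; rewrite {1}/lex_rel /=; case: eqP => [eij|_]; last by right.
by case: _ / eij y => y; rewrite tagged_asE; left; exists y.
Qed.

(** Each step must be an edge inside a block, so the walk never leaves the first one. *)
Lemma lex_path i (x : T i) s :
  path (lex_rel h e) (Tagged T x) s ->
  {in Tagged T x :: s &, forall u v, h (tag u) (tag v) = false} ->
  exists2 s', s = map (Tagged T) s' & path (@e i) x s'.
Proof.
elim: s x => [|v s IHs] x; first by exists [::].
rewrite /= => /andP[/lex_rel_in xv ps] hs.
have [y vE xy]: exists2 y, v = Tagged T y & e x y.
  by case: xv => // -[_]; rewrite (hs (Tagged T x) v) // !inE eqxx ?orbT.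
rewrite {}vE in ps hs *; have [u w us ws|s' -> ps'] := IHs y ps.
  by apply: hs; rewrite inE ?us ?ws orbT.
by exists (y :: s') => //=; rewrite xy.
Qed.

Lemma lex_sorted s :
  sorted (lex_rel h e) s -> s != [::] ->
  {in s &, forall u v, h (tag u) (tag v) = false} ->
  exists i s', s = map (@Tagged I i T) s' /\ sorted (@e i) s'.
Proof.
case: s => // [[i x] s] /= ps _ hs; have [s' -> ps'] := lex_path ps hs.
by exists i, (x :: s').
Qed.

Lemma Tagged_inj i : injective (@Tagged I i T).
Proof. by move=> x y /eqP; rewrite eq_Tagged => /eqP. Qed.

Lemma lex_disjoint m l : 0 < m -> (forall i j, h i j = false) ->
  (forall i, sparse m l (@e i)) -> sparse m l (lex_rel h e).
Proof.
move=> m_gt0 h0; case: l => [|[|l]] es.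
- move=> [i x] v; apply/negP => /lex_rel_in[[y _]|[_]]; rewrite ?h0 //.
  by rewrite (negbTE (es _ _ _)).
- split=> [[i x]|s us ss].
    apply: leq_trans ((es i).1 x); rewrite -(card_imset _ (@Tagged_inj i)).
    apply/subset_leq_card/subsetP => v; rewrite unfold_in => /lex_rel_in[[y ->]|[_]].
      by move=> xy; apply/imsetP; exists y.
    by rewrite h0.
  have [->//|s0] := eqVneq s [::].
  have [//|i [s' [sE ss']]] := lex_sorted ss s0.
  rewrite sE size_map; apply: (es i).2 => //.
  by rewrite -(map_inj_uniq (@Tagged_inj i)) -sE.
- move=> [i x] s us ss vs sm.
  have s0 : s != [::] by rewrite -size_eq0 sm -lt0n.
  have [//|j [s' [sE ss']]] := lex_sorted ss s0.
  have us' : uniq s' by rewrite -(map_inj_uniq (@Tagged_inj j)) -sE.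
  have xs y : y \in s' -> exists2 z, Tagged T y = Tagged T z & e x z.
    move=> ys; have /(allP vs) : Tagged T y \in s by rewrite sE map_f.
    by case/lex_rel_in => // -[_]; rewrite h0.
  (* The path is nonempty and its first vertex is a neighbour of the hub, so both lie in one
     block. *)
  have ij : i = j.
    case: s' sE xs {ss' us'} s0 => [->//|y s' _ xs _].
    by have [z /(congr1 tag)] := xs y (mem_head _ _).
  case: _ / ij s' sE ss' us' xs => s' sE ss' us' xs.
  apply: (es i x s' us' ss'); last by rewrite -sm sE size_map.
  by apply/allP => y /xs[z /Tagged_inj->].
Qed.

(** Cut the list into consecutive pairs: each contains an entry satisfying [a], and at most one
    entry is left over. *)
Lemma size_sorted_alternating (S : eqType) (a : pred S) s :
  sorted [rel x y | a x || a y] s -> size s <= (2 * count a s).+1.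
Proof.
have [n] := ubnP (size s); elim: n s => // n IHn [|x [|y s]] // sn ss.
have /= xy : a x || a y by case/andP: ss.
have ss' : sorted [rel x y | a x || a y] s.
  by move: ss => /= /andP[_ /path_sorted].
have := IHn s _ ss'; move: xy sn => /=; lia.
Qed.

(* The neighbourhood of a hub in block i consists of its neighbours in block i
   and of the blocks adjacent to i, which are pairwise non-adjacent.  If block i
   has no edge, a path stays in one of the adjacent blocks; otherwise these
   blocks have no edges and at least every other vertex of a path lies in
   block i. *)
Lemma lex_triangle_free m : 3 <= m ->
  (forall i j k, h i j -> h i k -> ~~ h j k) ->
  (forall i, sparse m 1 (@e i)) ->
  (forall i j, h i j -> sparse m 0 (@e i) \/ sparse m 0 (@e j)) ->
  sparse m 2 (lex_rel h e).
Proof.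
move=> m3 hT es h0 [i x] s us ss vs sm.
have vsP v : v \in s -> (exists2 y, v = Tagged T y & e x y) \/ h i (tag v).
  by move/(allP vs)/lex_rel_in => [|[]]; [left|right].
have [/existsP[y /existsP[z yz]]|e0] :=
    boolP [exists y, exists z, @e i y z].
  have e0 j (w w' : T j) : h i j -> e w w' = false.
    by move=> /h0[] eE; [move: (eE y z); rewrite yz | exact/negbTE].
  pose own (v : {i : I & T i}) := tag v == i.
  have le_own : count own s <= (m - 3)./2.
    apply: leq_trans ((es i).1 x).
    rewrite -size_filter cardE -(size_map (@Tagged I i T)).
    apply: uniq_leq_size; first exact: filter_uniq.
    move=> v; rewrite mem_filter => /andP[vi /vsP[[w -> xw]|hv]].
      by rewrite map_f // mem_enum.
    (* A loop of [h] at i would be a degenerate triangle. *)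
    by move/eqP: vi hv => -> hii; have := hT i i i hii hii; rewrite hii.
  have alt : sorted [rel u v | own u || own v] s.
    apply: (sub_in_sorted (P := mem s) _ _ ss); last exact/allP.
    move=> [j u] [k v] us' vs' /lex_rel_in uv /=; rewrite /own /=.
    apply/norP => -[/eqP ji /eqP ki].
    have hij : h i j by case: (vsP _ us') => // -[? /(congr1 tag)].
    have hik : h i k by case: (vsP _ vs') => // -[? /(congr1 tag)].
    case: uv => [[w _]|[_ /= jk]]; first by rewrite e0.
    by move: (hT i j k hij hik); rewrite jk.
  have : m <= (2 * (m - 3)./2).+1.
    rewrite -[X in X <= _]sm (leq_trans (size_sorted_alternating alt)) //.
    by rewrite ltnS leq_mul2l.
  lia.
have hs v : v \in s -> h i (tag v).
  case/vsP => // -[y _ xy]; case/negP: e0.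
  by apply/existsP; exists x; apply/existsP; exists y.
have s0 : s != [::] by rewrite -size_eq0 sm; lia.
have [|j [s' [sE ss']]] := lex_sorted ss s0.
  by move=> u v /hs iu /hs iv; apply/negbTE/hT/iv.
have us' : uniq s' by rewrite -(map_inj_uniq (@Tagged_inj j)) -sE.
by have := (es j).2 s' us' ss'; rewrite -(size_map (@Tagged I j T)) -sE sm ltnn.
Qed.

End LexRel.

(* [st a] is the level of [sparse] of the colour [a]. *)
Definition realizes (m n : nat) (st : nat -> nat) : Prop :=
  exists2 G : gallai_graph, #|G| = n & forall a, sparse m (st a) (@hue_rel G a).

Lemma realizes_le m n st st' : 3 <= m -> (forall a, st a <= st' a) ->
  realizes m n st -> realizes m n st'.
Proof.
by move=> m3 le_st [G nG sG]; exists G => // a; apply: sparse_le (sG a).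
Qed.

(** * Substitution into Gallai colourings *)

Section LexGraph.
Variables (H : gallai_graph) (G : H -> gallai_graph).

Definition lex_hue (u v : {i : H & G i}) : nat :=
  if tag u == tag v then hue (tagged u) (tagged_as u v)
  else hue (tag u) (tag v).

Lemma lex_hue_Tagged i (x y : G i) :
  lex_hue (Tagged G x) (Tagged G y) = hue x y.
Proof. by rewrite /lex_hue eqxx tagged_asE. Qed.

Lemma lex_hue_neq u v : tag u != tag v -> lex_hue u v = hue (tag u) (tag v).
Proof. by rewrite /lex_hue => /negbTE->. Qed.

Lemma lex_hue_sym u v : lex_hue u v = lex_hue v u.
Proof.
have [|neq] := eqVneq (tag u) (tag v).
  case: u v => i x [j y] /= ij; case: _ / ij y => y.
  by rewrite !lex_hue_Tagged hue_sym.
by rewrite [RHS]lex_hue_neq 1?eq_sym // lex_hue_neq // hue_sym.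
Qed.

(** If exactly two vertices share a block, their edges to the third have the same colour; otherwise
    the triangle lies in a block or comes from [H]. *)
Lemma lex_hue_gallai u v w : u != v -> v != w -> u != w ->
  [|| lex_hue u v == lex_hue v w, lex_hue v w == lex_hue u w
    | lex_hue u v == lex_hue u w].
Proof.
have [|uv] := eqVneq (tag u) (tag v).
  case: u v => i x [j y] /= ij; case: _ / ij y => y.
  have [|iw] := eqVneq i (tag w).
    case: w => k z /= ik; case: _ / ik z => z.
    by rewrite !eq_Tagged !lex_hue_Tagged; exact: hue_gallai.
  by move=> _ _ _; rewrite !(lex_hue_neq (v := w)) //= eqxx orbT.
have [vw|vw] := eqVneq (tag v) (tag w).
  by rewrite (@lex_hue_neq u v) // (@lex_hue_neq u w) -?vw // eqxx !orbT.
have [uw|uw] := eqVneq (tag u) (tag w).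
  rewrite (@lex_hue_neq u v) // (@lex_hue_neq v w) // -uw.
  by rewrite (hue_sym (tag v)) eqxx.
by rewrite !lex_hue_neq // => _ _ _; exact: hue_gallai.
Qed.

Definition lex_graph : gallai_graph :=
  GallaiGraph lex_hue_sym lex_hue_gallai.

Lemma lex_hue_rel a :
  @hue_rel lex_graph a =2 lex_rel (@hue_rel H a) (fun i => @hue_rel (G i) a).
Proof.
move=> u v; rewrite /hue_rel /lex_rel /= /lex_hue.
have [|uv] := eqVneq (tag u) (tag v).
  case: u v => i x [j y] /= ij; case: _ / ij y => y.
  by rewrite eq_Tagged tagged_asE.
by have -> : u != v by apply: contraNneq uv => ->.
Qed.

Lemma card_lex_graph : #|lex_graph| = \sum_i #|G i|.
Proof. by rewrite card_tagged sumnE big_map big_enum. Qed.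

End LexGraph.

Lemma eq_sparse m l (T : finType) (e e' : rel T) :
  e' =2 e -> sparse m l e -> sparse m l e'.
Proof.
move=> ee; case: l => [|[|l]] /= es.
- by move=> x y; rewrite ee.
- split=> [x|s us ss]; first by rewrite (eq_card (ee x)) es.1.
  by apply: es.2; rewrite // -(eq_sorted ee).
- move=> v s us ss vs; apply: (es v) => //; first by rewrite -(eq_sorted ee).
  by rewrite -(eq_all (ee v)).
Qed.

(** Colours are checked one at a time: those absent from [H] by [lex_disjoint], those occurring in
    [H] by [lex_triangle_free]. *)
Lemma realizes_lex m (H : gallai_graph) (n : H -> nat)
    (st : H -> nat -> nat) (st' : nat -> nat) : 3 <= m ->
  (forall i, realizes m (n i) (st i)) ->
  (forall a,
     (forall i j, ~~ @hue_rel H a i j) /\ (forall i, st i a <= st' a) \/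
     [/\ 2 <= st' a,
         forall i j k, @hue_rel H a i j -> @hue_rel H a i k ->
           ~~ @hue_rel H a j k,
         forall i, st i a <= 1 &
         forall i j, @hue_rel H a i j -> st i a = 0 \/ st j a = 0]) ->
  realizes m (\sum_i n i) st'.
Proof.
move=> m3 /fin_all_exists2[G nG sG] Hst; exists (lex_graph G).
  by rewrite card_lex_graph; apply: eq_bigr.
move=> a; apply: (eq_sparse (@lex_hue_rel _ G a)).
case: (Hst a) => [[h0 le_st]|[st2 hT le1 h0]].
  apply: lex_disjoint => [|i j|i]; [lia | exact/negbTE|].
  exact: sparse_le (sG i a).
apply: (@sparse_le m 2) => //; apply: lex_triangle_free => // [i|i j].
  exact: sparse_le (sG i a).
by case/h0 => st0; [left; have := sG i a | right; have := sG j a]; rewrite st0.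
Qed.

(** * Pentagons and doubling *)

Lemma hue2_gallai (T : Type) (f : T -> T -> bool) (p q : nat) (x y z : T) :
  let c u v := if f u v then p else q in
  [|| c x y == c y z, c y z == c x z | c x y == c x z].
Proof.
by move=> /=; case: (f x y); case: (f y z); case: (f x z); rewrite !eqxx ?orbT.
Qed.

Definition two_hue_graph (T : finType) (f : rel T) (fS : symmetric f) p q :=
  @GallaiGraph T (fun x y => if f x y then p else q)
    (fun x y => congr1 (fun b : bool => if b then p else q) (fS x y))
    (fun x y z _ _ _ => hue2_gallai f p q x y z).

(* [i - j] is truncated, so the sum is the distance |i - j|. *)
Definition pentagon_adj (i j : 'I_5) : bool :=
  (i - j) + (j - i) \in [:: 1; 4].

Lemma pentagon_adj_sym : symmetric pentagon_adj.
Proof. by move=> i j; rewrite /pentagon_adj addnC. Qed.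

Lemma pentagon_triangle_free i j k :
  pentagon_adj i j -> pentagon_adj i k -> ~~ pentagon_adj j k.
Proof.
by move: i j k => [[|[|[|[|[|i]]]]] ?] [[|[|[|[|[|j]]]]] ?] [[|[|[|[|[|k]]]]] ?].
Qed.

(** The complement of a 5-cycle is again a 5-cycle. *)
Lemma pentagon_compl_triangle_free i j k :
  i != j -> i != k -> ~~ pentagon_adj i j -> ~~ pentagon_adj i k -> j != k ->
  pentagon_adj j k.
Proof.
by move: i j k => [[|[|[|[|[|i]]]]] ?] [[|[|[|[|[|j]]]]] ?] [[|[|[|[|[|k]]]]] ?].
Qed.

(* Blocks 1 and 4 are adjacent in colour q only, blocks 2 and 3 in colour p
   only; so B may carry colour p and C may carry colour q. *)
Lemma realizes_pentagon m p q nA nB nC sA sB sC : 3 <= m -> p != q ->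
  realizes m nA sA -> realizes m nB sB -> realizes m nC sC ->
  sA p = 0 -> sA q = 0 -> sB p <= 1 -> sB q = 0 -> sC p = 0 -> sC q <= 1 ->
  realizes m (nA + 2 * nB + 2 * nC)
    (fun a => if a \in [:: p; q] then 2 else maxn (sA a) (maxn (sB a) (sC a))).
Proof.
move=> m3 pq rA rB rC Ap Aq Bp Bq Cp Cq.
pose H := two_hue_graph pentagon_adj_sym p q.
pose pick X (A B C : X) (i : H) := nth A [:: A; B; C; C; B] (i : 'I_5).
have -> : nA + 2 * nB + 2 * nC = \sum_(i : H) pick _ nA nB nC i.
  by rewrite !big_ord_recl big_ord0 /pick /=; lia.
apply: (realizes_lex (st := pick _ sA sB sC)) => // [|a].
  by case=> [[|[|[|[|[|]]]]]].
have hE (i j : H) :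
    @hue_rel H a i j = (i != j) && ((if pentagon_adj i j then p else q) == a).
  by [].
have [ap|ap] := eqVneq a p.
  have {}hE (i j : H) : @hue_rel H a i j -> pentagon_adj i j.
    by rewrite hE ap; case: pentagon_adj => //; rewrite [q == p]eq_sym (negbTE pq) andbF.
  right; rewrite ap in hE *; rewrite !inE eqxx; split=> //.
  - move=> i j k /hE ij /hE ik; apply/negP => /hE.
    exact/negP/(pentagon_triangle_free ij ik).
  - by case=> [[|[|[|[|[|]]]]]] //= ?; rewrite /pick /= ?Ap ?Cp.
  - move=> i j /hE.
    move: i j => [[|[|[|[|[|i]]]]] ?] [[|[|[|[|[|j]]]]] ?] //= _;
      by rewrite /pick /= ?Ap ?Cp; auto.
have [aq|aq] := eqVneq a q.
  have {}hE (i j : H) : @hue_rel H a i j -> i != j /\ ~~ pentagon_adj i j.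
    by rewrite hE aq; case: pentagon_adj; rewrite ?(negbTE pq) ?andbF // => /andP[].
  right; rewrite aq in hE *; rewrite !inE eqxx orbT; split=> //.
  - move=> i j k /hE[ij ijn] /hE[ik ikn]; apply/negP => /hE[jk].
    by rewrite (pentagon_compl_triangle_free ij ik ijn ikn jk).
  - by case=> [[|[|[|[|[|]]]]]] //= ?; rewrite /pick /= ?Aq ?Bq.
  - move=> i j /hE[].
    move: i j => [[|[|[|[|[|i]]]]] ?] [[|[|[|[|[|j]]]]] ?] //= _ _;
      by rewrite /pick /= ?Aq ?Bq; auto.
left; split=> [i j|].
  by rewrite hE; case: ifP => _; rewrite ![_ == a]eq_sym ?(negbTE ap) ?(negbTE aq) andbF.
rewrite !inE (negbTE ap) (negbTE aq) /=.
by case=> [[|[|[|[|[|]]]]]] //= ?; rewrite /pick /=; lia.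
Qed.

Lemma realizes_double m n q st : 3 <= m -> st q = 0 -> realizes m n st ->
  realizes m n.*2 (fun a => if a == q then 2 else st a).
Proof.
move=> m3 stq rn.
have fS : symmetric (fun _ _ : bool => true) by [].
(* Using q twice makes [H] a K_2 in the single colour q. *)
pose H := two_hue_graph fS q q.
have -> : n.*2 = \sum_(i : H) n.
  by rewrite sum_nat_const [#|H|]card_bool mul2n.
apply: (realizes_lex (st := fun=> st)) => // a.
have hE (i j : H) : @hue_rel H a i j = (i != j) && (q == a) by [].
have [aq|aq] := eqVneq a q; last first.
  by left; split=> // i j; rewrite hE [q == a]eq_sym (negbTE aq) andbF.
right; rewrite aq stq in hE *; split=> // [i j k|i j _]; last by left.
by rewrite !hE eqxx !andbT; case: i j k => [] [] [].
Qed.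

(** * The innermost blocks *)

Lemma two_hue_degree (T : finType) (f : rel T) (fS : symmetric f) p q d :
  p != q ->
  (forall x, #|[pred y | (x != y) && f x y]| <= d) ->
  (forall x, #|[pred y | (x != y) && ~~ f x y]| <= d) ->
  forall x a, #|@hue_rel (two_hue_graph fS p q) a x| <= if a \in [:: p; q] then d else 0.
Proof.
move=> pq d1 d2 x a; rewrite !inE.
have [->|ap] := eqVneq a p.
  rewrite -(eq_card (A := [pred y | (x != y) && f x y])) ?d1 // => y.
  by rewrite !unfold_in /hue_rel /=; case: (f x y);
    rewrite ?eqxx // [q == p]eq_sym (negbTE pq).
have [->|aq] := eqVneq a q.
  rewrite -(eq_card (A := [pred y | (x != y) && ~~ f x y])) ?d2 // => y.
  by rewrite !unfold_in /hue_rel /=; case: (f x y); rewrite ?eqxx // (negbTE pq).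
rewrite eq_card0 // => y; rewrite unfold_in /hue_rel /=.
by case: (f x y); rewrite ![_ == a]eq_sym ?(negbTE ap) ?(negbTE aq) andbF.
Qed.

(** The boolean serves as a level: 1 for p and q, 0 for other colours. With fewer than m vertices no
    path is too long, so only degrees matter. *)
Lemma realizes_two_hue m (T : finType) (f : rel T) (fS : symmetric f) p q :
  p != q -> #|T| < m ->
  (forall x, #|[pred y | (x != y) && f x y]| <= (m - 3)./2) ->
  (forall x, #|[pred y | (x != y) && ~~ f x y]| <= (m - 3)./2) ->
  realizes m #|T| (fun a => a \in [:: p; q]).
Proof.
move=> pq Tm d1 d2; exists (two_hue_graph fS p q) => // a.
have [ain|ain] := boolP (a \in _) => /=.
  split=> [x|s us _].
    by have := two_hue_degree (fS := fS) pq d1 d2 x a; rewrite ain.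
  by rewrite -(card_uniqP us) (leq_ltn_trans (max_card _)).
move=> x y; have := two_hue_degree (fS := fS) pq d1 d2 x a; rewrite (negbTE ain) leqn0.
by move/eqP/card0_eq/(_ y); exact: negbT.
Qed.

(* Two disjoint cliques of size t + 1 and the complete bipartite graph between
   them. *)
Lemma realizes_bipartite m p q t : p != q -> (t.+1).*2 < m -> t.+1 <= (m - 3)./2 ->
  realizes m (t.+1).*2 (fun a => a \in [:: p; q]).
Proof.
move=> pq tm tr.
have fS : symmetric (fun x y : bool * 'I_t.+1 => x.1 == y.1).
  by move=> x y; rewrite eq_sym.
have cT : #|{: bool * 'I_t.+1}| = (t.+1).*2 by rewrite card_prod card_bool card_ord mul2n.
rewrite -cT; apply: (realizes_two_hue fS); rewrite ?cT // => -[b x];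
  apply: leq_trans tr; rewrite -[X in _ <= X]card_ord.
  rewrite -(card_in_imset (f := snd)) ?max_card //.
  by move=> [b1 y] [b2 z]; rewrite !inE /= => /andP[_ /eqP<-] /andP[_ /eqP<-] ->.
rewrite -(card_in_imset (f := snd)) ?max_card //.
move=> [b1 y] [b2 z]; rewrite !inE /= => /andP[_ b1b] /andP[_ b2b] ->.
by case: b b1 b2 b1b b2b => [] [] [].
Qed.

(** Join points of Z_(4t+1) at cyclic distance at most t; this graph and its complement are
    2t-regular. For m = 4t + 3 it has the largest order, 2r + 1, that degrees at most r = (m-3)/2
    allow. For m = 1 mod 4 this order would need an r-regular graph with r and m - 2 both odd, hence
    the choice b = m - 3 there. *)
Lemma realizes_circulant m p q t :
  p != q -> (4 * t).+1 < m -> 0 < t -> 2 * t <= (m - 3)./2 ->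
  realizes m (4 * t).+1 (fun a => a \in [:: p; q]).
Proof.
move=> pq tm t0 tr.
pose f (x y : 'I_(4 * t).+1) := let d := (x - y) + (y - x) in (d <= t) || (3 * t < d).
have fS : symmetric f by move=> x y; rewrite /f addnC.
(* The residue of y - x: degrees are bounded by listing the possible differences. *)
pose d (x y : 'I_(4 * t).+1) : nat := if x <= y then y - x else y + (4 * t).+1 - x.
have d_inj x : injective (d x).
  move=> y z; rewrite /d => dyz; apply: val_inj => /=.
  have := (ltn_ord x, ltn_ord y, ltn_ord z) => -[[xn yn] zn].
  by move: dyz; case: (leqP x y); case: (leqP x z); lia.
have card_le (A : pred 'I_(4 * t).+1) (s : seq nat) x :
    (forall y, A y -> d x y \in s) -> #|A| <= size s.
  move=> As; rewrite cardE -(size_map (d x)); apply: uniq_leq_size.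
    by rewrite map_inj_uniq ?enum_uniq.
  by move=> _ /mapP[y + ->]; rewrite mem_enum; exact: As.
rewrite -[X in realizes _ X _]card_ord.
apply: (realizes_two_hue fS); rewrite ?card_ord // => x;
  apply: leq_trans tr.
  apply: leq_trans (card_le _ (iota 1 t ++ iota (3 * t).+1 t) x _) _ => [y|].
    have := (ltn_ord x, ltn_ord y) => -[xn yn].
    rewrite /= -val_eqE /= /f /d mem_cat !mem_iota; case: (leqP x y); lia.
  by rewrite size_cat !size_iota; lia.
apply: leq_trans (card_le _ (iota t.+1 (2 * t)) x _) _ => [y|].
  have := (ltn_ord x, ltn_ord y) => -[xn yn].
  rewrite /= -val_eqE /= /f /d mem_iota; case: (leqP x y); lia.
by rewrite size_iota.
Qed.

Lemma realizes_clique m n p : n < m -> n.-1 <= (m - 3)./2 ->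
  realizes m n (fun a => a == p).
Proof.
move=> nm nr.
have fS : symmetric (fun x y : 'I_n => true) by [].
exists (two_hue_graph fS p p) => [|a]; first exact: card_ord.
have [->|ap] := eqVneq a p => /=.
  split=> [x|s us _].
    apply: leq_trans nr; rewrite -[X in X.-1]card_ord -(cardC1 x).
    apply: subset_leq_card; apply/subsetP => y.
    by rewrite !inE unfold_in eq_sym => /andP[].
  by rewrite -(card_uniqP us) (leq_ltn_trans (max_card _)) // card_ord.
by move=> x y; rewrite /hue_rel /= [p == a]eq_sym (negbTE ap) andbF.
Qed.

(** The kipas has m + 1 vertices, too many for K_m. The doubled boolean is level 2 at p. *)
Lemma realizes_clique_free m p : realizes m m (fun a => (a == p).*2).
Proof.
have fS : symmetric (fun x y : 'I_m => true) by [].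
exists (two_hue_graph fS p p) => [|a]; first exact: card_ord.
have [->|ap] := eqVneq a p => /=.
  move=> v s us _ vs sm.
  have : uniq (v :: s).
    by rewrite /= us andbT; apply/negP => /(allP vs); rewrite /hue_rel eqxx.
  by move/card_uniqP => /= vsE; have := max_card (mem (v :: s));
    rewrite vsE sm card_ord ltnn.
by move=> x y; rewrite /hue_rel /= [p == a]eq_sym (negbTE ap) andbF.
Qed.

(** * Nested pentagons *)

(** The colours p and q differ from all pentagon colours, so they occur only inside innermost blocks
    and keep level 1. *)
Lemma realizes_nested m b j p q : 3 <= m -> 2 * j <= p -> 2 * j <= q ->
  realizes m b (fun a => a \in [:: p; q]) ->
  realizes m (5 ^ j * b) (fun a => if a < 2 * j then 2 else a \in [:: p; q]).
Proof.
move=> m3 + + rb; elim: j => [|j IHj] jp jq; first by rewrite mul1n.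
have {IHj} rj : realizes m (5 ^ j * b) _ := IHj ltac:(lia) ltac:(lia).
have -> : 5 ^ j.+1 * b = 5 ^ j * b + 2 * (5 ^ j * b) + 2 * (5 ^ j * b).
  by rewrite expnS; lia.
have jj : 2 * j != (2 * j).+1 by lia.
apply: realizes_le (realizes_pentagon m3 jj rj rj rj _ _ _ _ _ _) => // *;
  rewrite ?inE; repeat case: ifP; lia.
Qed.

(** Only one block of the new pentagon is trimmed. The extra colours of the other four are e and a
    colour of that pentagon, so e alone remains extra, and the loss b - c occurs just once, in the
    innermost block. *)
Lemma realizes_nested_trimmed m b c j e : 3 <= m -> c <= b -> 2 * j <= e ->
  (forall p q, p != q -> realizes m b (fun a => a \in [:: p; q])) ->
  realizes m c (fun a => a == e) ->
  realizes m (5 ^ j * b - (b - c)) (fun a => if a < 2 * j then 2 else a == e).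
Proof.
move=> m3 cb + rb rc; elim: j => [|j IHj] je.
  by rewrite mul1n subKn.
have {IHj} rj : realizes m (5 ^ j * b - (b - c)) _ := IHj ltac:(lia).
have -> : 5 ^ j.+1 * b - (b - c) =
    (5 ^ j * b - (b - c)) + 2 * (5 ^ j * b) + 2 * (5 ^ j * b).
  have : 0 < 5 ^ j by rewrite expn_gt0.
  rewrite expnS; nia.
have rB q : 2 * j <= q -> q != e ->
    realizes m (5 ^ j * b) (fun a => if a < 2 * j then 2 else a \in [:: q; e]).
  by move=> jq qe; apply: realizes_nested; rewrite // 1?ltnW //; [lia | exact: rb].
have jj : 2 * j != (2 * j).+1 by lia.
apply: realizes_le (realizes_pentagon m3 jj rj
    (rB (2 * j) _ _) (rB (2 * j).+1 _ _) _ _ _ _ _ _);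
  move=> // *; rewrite ?inE; repeat case: ifP; lia.
Qed.

(** Each round adds four trimmed blocks. Negative terms stand on the left of the equation for N to
    avoid truncation. *)
Lemma realizes_even m n b c i : 3 <= m -> c <= b ->
  realizes m n (fun a => if a < 2 then 2 else 0) ->
  (forall p q, p != q -> realizes m b (fun a => a \in [:: p; q])) ->
  (forall p, realizes m c (fun a => a == p)) ->
  exists2 N, N + i * (4 * (b - c)) + 5 * b = n + 5 ^ i.+1 * b &
    realizes m N (fun a => if a < 2 * i.+1 then 2 else 0).
Proof.
move=> m3 cb rn rb rc; elim: i => [|i [N NE rN]].
  by exists n; rewrite ?expn1 ?mul0n ?addn0.
pose g := 5 ^ i.+1 * b - (b - c).
exists (N + 2 * g + 2 * g).
  have : 0 < 5 ^ i.+1 by rewrite expn_gt0.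
  rewrite /g [5 ^ i.+2]expnS; nia.
have rg e : 2 * i.+1 <= e -> realizes m g _ :=
  fun ie => realizes_nested_trimmed m3 cb ie rb (rc e).
have ii : 2 * i.+1 != (2 * i.+1).+1 by lia.
apply: realizes_le (realizes_pentagon m3 ii rN
    (rg (2 * i.+1) _) (rg (2 * i.+1).+1 _) _ _ _ _ _ _);
  move=> // *; rewrite ?inE; repeat case: ifP; lia.
Qed.

(** * From realizations to Ramsey numbers *)

Lemma set2_inj (T : finType) (x y z t : T) : [set x; y] = [set z; t] ->
  (x = z /\ y = t) \/ (x = t /\ y = z).
Proof.
move=> E.
have : x \in [set z; t] by rewrite -E set21.
have : y \in [set z; t] by rewrite -E set22.
have : z \in [set x; y] by rewrite E set21.
have : t \in [set x; y] by rewrite E set22.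
by rewrite !inE; do 4![case/orP => /eqP ?]; subst; auto.
Qed.

Lemma ramsey_critical m :
  realizes m (ramsey 2 (kipas m)).-1 (fun a => if a < 2 then 2 else 0).
Proof.
rewrite /ramsey; case: ex_minnP => -[//|N] _ minN /=.
(* [ramsey_pred] excludes 0, so for N = 0 minimality yields no colouring and the empty graph
   serves. *)
have [N0|N_gt0] := posnP N.
  have fS : symmetric (fun x y : 'I_N => true) by [].
  exists (two_hue_graph fS 0 0) => [|a]; first exact: card_ord.
  have noN (x : 'I_N) : False by case: x; rewrite N0.
  by case: ifP => _ /= x; case: (noN x).
have /forallPn[c nc] : ~~ [forall c : coloring N 2, mono_copy (kipas m) c].
  apply/negP => cN; have := minN N.
  by rewrite /ramsey_pred N_gt0 cN ltnn => /(_ isT).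
have fS : symmetric (fun x y : 'I_N => c [set x; y] == ord0).
  by move=> x y; rewrite setUC.
exists (two_hue_graph fS 0 1) => [|a]; first exact: card_ord.
case: ifP => /= [a2|a2]; last first.
  by move=> x y; rewrite /hue_rel /=; apply/negP => /andP[_ /eqP]; case: ifP; lia.
move=> v s us ss vs sm; case/negP: nc; apply/existsP.
have relP x y : @hue_rel (two_hue_graph fS 0 1) a x y ->
    x != y /\ c [set x; y] = inord a.
  rewrite /hue_rel => /andP[-> /= /eqP ca]; split=> //; apply: val_inj.
  rewrite /= inordK // -ca; case: (c _) => -[|[|]] //.
exists (inord a); apply/existsP.
pose f (x : option 'I_m) := if x is Some i then nth v s i else v.
have vP i : i < m -> v != nth v s i /\ c [set v; nth v s i] = inord a.
  by move=> im; apply: relP; apply: (allP vs); rewrite mem_nth ?sm.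
exists [ffun x => f x]; apply/andP; split.
  apply/injectiveP => -[i|] [j|]; rewrite !ffunE /f // => fij.
  - congr Some; apply: val_inj; apply/eqP.
    have := @nth_uniq _ v s i j; rewrite sm !ltn_ord us => /(_ isT isT isT) <-; exact/eqP.
  - by case: (vP i) => //; rewrite fij eqxx.
  - by case: (vP j) => //; rewrite -fij eqxx.
have pathP i j : i.+1 = j -> j < m -> c [set nth v s i; nth v s j] = inord a.
  move=> <- im; have := sortedP v ss i; rewrite sm => /(_ im).
  by case/relP.
apply/forallP => x; apply/forallP => y; apply/implyP; rewrite !ffunE.
case: x y => [i|] [j|] //= xy; apply/eqP.
- case/orP: xy => /eqP ij; first exact: pathP.
  by rewrite setUC; apply: pathP.
- by rewrite setUC; case: (vP i).
- by case: (vP j).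
Qed.

(** Otherwise the colouring restricts to a Gallai colouring on [gallai_ramsey] vertices, with
    colours below k since the others have level 0; it then contains a kipas that [sparse]
    forbids. *)
Lemma realizes_lt_gallai_ramsey m n k st : 3 <= m -> 0 < k ->
  (forall a, k <= a -> st a = 0) -> realizes m n st ->
  n < gallai_ramsey k (kipas m).
Proof.
case: k => // k m3 _ st0 [G nG sG].
rewrite /gallai_ramsey; case: ex_minnP => N /andP[N_gt0 /forallP cN] _.
rewrite ltnNge -nG; apply/negP => NG.
pose g (x : 'I_N) : G := enum_val (widen_ord NG x).
have g_inj : injective g.
  by move=> x y /enum_val_inj /(congr1 val) /= /val_inj.
have hue_k x y : x != y -> hue (g x) (g y) <= k.
  move=> xy; rewrite leqNgt; apply/negP => kc.
  have := sG (hue (g x) (g y)); rewrite st0 // => /(_ (g x) (g y)).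
  by rewrite /hue_rel eqxx andbT (inj_eq g_inj) xy.
(* By symmetry of [hue], the ordered pair picked does not matter. *)
pose c : coloring N k.+1 := [ffun S =>
  if [pick u : 'I_N * 'I_N | S == [set u.1; u.2]] is Some u
  then inord (hue (g u.1) (g u.2)) else ord0].
have cE x y : x != y -> c [set x; y] = hue (g x) (g y) :> nat.
  move=> xy; rewrite ffunE; case: pickP => [[z t] /eqP /=|/(_ (x, y))]; last first.
    by rewrite eqxx.
  case/set2_inj => -[<- <-]; rewrite inordK ?ltnS ?hue_k //; first exact: hue_sym.
  by rewrite eq_sym.
have gc : gallai c.
  apply/negP => /existsP[x /existsP[y /existsP[z]]].
  case/and5P => xy yz xz h1 /andP[h2 h3].
  move: h1 h2 h3; rewrite -!val_eqE /= !cE // => h1 h2 h3.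
  have := @hue_gallai G (g x) (g y) (g z); rewrite !(inj_eq g_inj) => /(_ xy yz xz).
  by rewrite (negbTE h1) (negbTE h2) (negbTE h3).
have /existsP[a /existsP[f /andP[/injectiveP f_inj /forallP fa]]] :=
  implyP (cN c) gc.
have {}fa x y : kipas_adj x y -> hue_rel a (g (f x)) (g (f y)).
  move=> xy; have /forallP/(_ y)/implyP/(_ xy)/eqP cxy := fa x.
  have fxy : f x != f y.
    by rewrite (inj_eq f_inj); apply: contraTneq xy => ->; rewrite kipas_adj_irrefl.
  by rewrite /hue_rel (inj_eq g_inj) fxy -cxy cE /=.
(* Every level weakens to the absence of a kipas; adding two selects that branch by computation. *)
have sa : sparse m (st a).+2 (@hue_rel G a).
  by apply: (sparse_le (l := st a)) => //; rewrite !leqW.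
apply: (sa (g (f None)) [seq g (f (Some i)) | i <- enum 'I_m]).
- by rewrite map_inj_uniq ?enum_uniq // => i j /g_inj /f_inj [].
- have succ_iota i l : path [rel a b | a.+1 == b] i (iota i.+1 l).
    by elim: l i => //= l IHl i; rewrite eqxx IHl.
  have : sorted [rel a b | a.+1 == b] (map val (enum 'I_m)).
    by rewrite val_enum_ord; case: (m) => //= ?; exact: succ_iota.
  rewrite !sorted_map; apply: sub_sorted => i j /= ij; apply: fa.
  by rewrite /= ij.
- by apply/allP => _ /mapP[i _ ->]; exact: fa.
- by rewrite size_map size_enum_ord.
Qed.

Lemma ramsey_gt0 k G : 0 < ramsey k G.
Proof. by rewrite /ramsey; case: ex_minnP => N /andP[]. Qed.

(** * The lower bounds *)

Lemma gallai_ramsey_kipas_bounds m b c i : 3 <= m -> c <= b -> c < m ->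
  c.-1 <= (m - 3)./2 ->
  (forall p q, p != q -> realizes m b (fun a => a \in [:: p; q])) ->
  exists2 N,
    N + i * (4 * (b - c)) + 5 * b = (ramsey 2 (kipas m)).-1 + 5 ^ i.+1 * b &
    N < gallai_ramsey (2 * i.+1) (kipas m) /\
    N.*2 < gallai_ramsey (2 * i.+1).+1 (kipas m).
Proof.
move=> m3 cb cm cr rb.
have [N NE rN] := realizes_even i m3 cb (ramsey_critical m) rb
  (fun p => realizes_clique p cm cr).
exists N => //; split.
  apply: (realizes_lt_gallai_ramsey m3 _ _ rN) => // a ia; case: ifP; lia.
have Nq : (if 2 * i.+1 < 2 * i.+1 then 2 else 0) = 0 by rewrite ltnn.
apply: (realizes_lt_gallai_ramsey m3 _ _ (realizes_double m3 Nq rN)) => // a ia.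
by repeat case: ifP; lia.
Qed.

Lemma gallai_ramsey_kipas_mod1 m i : 7 <= m -> m = 1 %[mod 4] ->
  exists2 N,
    N + i * (2 * (m - 5)) + 5 * (m - 3) =
      (ramsey 2 (kipas m)).-1 + 5 ^ i.+1 * (m - 3) &
    N < gallai_ramsey (2 * i.+1) (kipas m) /\
    N.*2 < gallai_ramsey (2 * i.+1).+1 (kipas m).
Proof.
(* Here r = (m-3)/2 = t + 1, b = 2r and c = r + 1, so 4(b - c) = 2(m - 5). *)
move=> m7 m1; pose t := (m %/ 4).*2.-2.
have mE : m = (t.+1).*2 + 3 by rewrite /t; lia.
have rb p q : p != q -> realizes m (m - 3) (fun a => a \in [:: p; q]).
  have -> : m - 3 = (t.+1).*2 by lia.
  by move=> pq; apply: realizes_bipartite => //; lia.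
have [||||N NE Nlt] := gallai_ramsey_kipas_bounds (c := t.+2) i _ _ _ _ rb; try lia.
by exists N => //; rewrite -NE; nia.
Qed.

Lemma gallai_ramsey_kipas_mod3 m i : 7 <= m -> m = 3 %[mod 4] ->
  exists2 N,
    N + i * (2 * (m - 3)) + 5 * (m - 2) =
      (ramsey 2 (kipas m)).-1 + 5 ^ i.+1 * (m - 2) &
    N < gallai_ramsey (2 * i.+1) (kipas m) /\
    N.*2 < gallai_ramsey (2 * i.+1).+1 (kipas m).
Proof.
(* Here r = 2t, b = 2r + 1 and c = r + 1, so 4(b - c) = 2(m - 3). *)
move=> m7 m3; pose t := m %/ 4.
have mE : m = 4 * t + 3 by rewrite /t; lia.
have rb p q : p != q -> realizes m (m - 2) (fun a => a \in [:: p; q]).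
  have -> : m - 2 = (4 * t).+1 by lia.
  by move=> pq; apply: realizes_circulant => //; lia.
have [||||N NE Nlt] := gallai_ramsey_kipas_bounds (c := (2 * t).+1) i _ _ _ _ rb; try lia.
by exists N => //; rewrite -NE; nia.
Qed.

(** Either double a critical 2-colouring, or substitute K_m in colour 2 for each vertex of a
    pentagon coloured with 0 and 1. *)
Lemma gallai_ramsey3_kipas m : 3 <= m ->
  ((ramsey 2 (kipas m)).-1.*2 < gallai_ramsey 3 (kipas m)) /\
  5 * m < gallai_ramsey 3 (kipas m).
Proof.
move=> m3; split.
  apply: (realizes_lt_gallai_ramsey m3 _ _
    (realizes_double (q := 2) m3 _ (ramsey_critical m))) => // a a3.
  by repeat case: ifP; lia.
have r2 := realizes_clique_free m 2.
have -> : 5 * m = m + 2 * m + 2 * m by lia.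
apply: (realizes_lt_gallai_ramsey m3 _ _
  (realizes_pentagon (p := 0) (q := 1) m3 _ r2 r2 r2 _ _ _ _ _ _)) => // a a3.
by rewrite !inE; repeat case: ifP; lia.
Qed.

Unset Implicit Arguments.
Import Order.TTheory GRing.Theory Num.Theory.
Local Open Scope ring_scope.

(** In the application 2i is k - 2 or k - 3 according to parity, and d is m - 5 or m - 3. *)
Lemma size_closed_form (N R b d i : nat) : (0 < R)%N ->
  (N + i * (2 * d) + 5 * b = R.-1 + 5 ^ i.+1 * b)%N ->
  N%:Z = R%:Z - 1 + 5 * b%:Z * (5 ^+ i - 1) - d%:Z * (2 * i%:Z).
Proof.
case: R => // R _ /(congr1 Posz); rewrite !PoszD !PoszM -pred_Sn.
have -> : (5 ^ i.+1)%N%:Z = 5 * 5 ^+ i :> int by rewrite -natz natrX exprS.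
move=> NE; have -> : N%:Z = N%:Z + i%:Z * (2 * d%:Z) + 5 * b%:Z
    - i%:Z * (2 * d%:Z) - 5 * b%:Z by ring.
by rewrite NE intS; ring.
Qed.

Theorem theorem4 (k m : nat) (hk : (2 <= k)%N) (hm : (7 <= m)%N)
    (hodd : odd m) :
  let GR := (gallai_ramsey k (kipas m))%:Z in
  let R2 := (ramsey 2 (kipas m))%:Z in
  [/\ k = 3%N ->
        Num.max (2 * R2 - 1) (5 * m%:Z + 1) <= GR,
      ~~ odd k -> m = 1 %[mod 4] ->
        R2 + 5 * (m%:Z - 3) * (5 ^+ (k - 2)./2 - 1)
          - (m%:Z - 5) * (k%:Z - 2) <= GR,
      ~~ odd k -> m = 3 %[mod 4] ->
        R2 + 5 * (m%:Z - 2) * (5 ^+ (k - 2)./2 - 1)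
          - (m%:Z - 3) * (k%:Z - 2) <= GR,
      (5 <= k)%N -> odd k -> m = 1 %[mod 4] ->
        2 * (R2 + 5 * (m%:Z - 3) * (5 ^+ (k - 3)./2 - 1)
               - (m%:Z - 5) * (k%:Z - 3)) - 1 <= GR
    & (5 <= k)%N -> odd k -> m = 3 %[mod 4] ->
        2 * (R2 + 5 * (m%:Z - 2) * (5 ^+ (k - 3)./2 - 1)
               - (m%:Z - 3) * (k%:Z - 3)) - 1 <= GR].
Proof.
move=> GR R2; rewrite {}/GR {}/R2.
have R_gt0 := ramsey_gt0 2 (kipas m).
have hm3 : m%:Z - 3 = (m - 3)%N%:Z by lia.
have hm2 : m%:Z - 2 = (m - 2)%N%:Z by lia.
have hm5 : m%:Z - 5 = (m - 5)%N%:Z by lia.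
have evenP : ~~ odd k -> exists i, k = (2 * i.+1)%N.
  by exists ((k - 2)./2)%N; lia.
have oddP : (5 <= k)%N -> odd k -> exists i, k = (2 * i.+1).+1.
  by exists ((k - 3)./2)%N; lia.
have half2 i : ((2 * i.+1 - 2)./2 = i)%N by lia.
have half3 i : (((2 * i.+1).+1 - 3)./2 = i)%N by lia.
have sub2 i : (2 * i.+1)%N%:Z - 2 = 2 * i%:Z by lia.
have sub3 i : (2 * i.+1).+1%:Z - 3 = 2 * i%:Z by lia.
split.
- move=> ->; have [] := @gallai_ramsey3_kipas m; first by lia.
  by rewrite ge_max; lia.
- move=> /evenP[i ->] m1.
  have [N /(size_closed_form _ _ _ _ _ R_gt0) NE []] :=
    gallai_ramsey_kipas_mod1 i hm m1.
  (* The claimed bound is N + 1; naming the products leaves a linear goal. *)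
  by rewrite half2 sub2 hm3 hm5;
    move: NE; set u := 5 * _ * _; set v := _ * (_ * _); lia.
- move=> /evenP[i ->] m3.
  have [N /(size_closed_form _ _ _ _ _ R_gt0) NE []] :=
    gallai_ramsey_kipas_mod3 i hm m3.
  by rewrite half2 sub2 hm3 hm2;
    move: NE; set u := 5 * _ * _; set v := _ * (_ * _); lia.
- move=> k5 /(oddP k5)[i ->] m1.
  have [N /(size_closed_form _ _ _ _ _ R_gt0) NE [_]] :=
    gallai_ramsey_kipas_mod1 i hm m1.
  (* Now 2N < GR, which is 2(N + 1) - 1 <= GR. *)
  by rewrite half3 sub3 hm3 hm5;
    move: NE; set u := 5 * _ * _; set v := _ * (_ * _); lia.
- move=> k5 /(oddP k5)[i ->] m3.
  have [N /(size_closed_form _ _ _ _ _ R_gt0) NE [_]] :=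
    gallai_ramsey_kipas_mod3 i hm m3.
  by rewrite half3 sub3 hm3 hm2;
    move: NE; set u := 5 * _ * _; set v := _ * (_ * _); lia.
Qed.
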